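(* Let $n\geq 2$ and let $p$ be the largest prime with $p\leq n$. Then for every vector $v\in\mathbb{R}^n$ whose coordinates are pairwise distinct and do not sum to $0$, and every hyperplane $H\subset\mathbb{R}^n$ through the origin, \[ |H\cap S_nv|\leq \frac{n!}{p}. \] In particular, if $n\geq 3$ and $n=p$ or $n=p+1$, then \[ \max_{v,H}|H\cap S_nv|=\begin{cases}(n-1)!,& n\text{ odd},\\ n(n-2)!,& n\text{ even},\end{cases} \] where the maximum is over all $v\in\mathbb{R}^n$ with pairwise distinct coordinates not lying in the hyperplane $\sum_i x_i=0$ and all hyperplanes $H\subset\mathbb{R}^n$ through the origin.
   Context: The symmetric group $S_n$ acts on $\mathbb{R}^n$ by permuting coordinates; $S_nv$ denotes the orbit of $v$. *)

(* Defs.v *)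
From HB Require Import structures.
From mathcomp Require Import all_boot all_order all_algebra all_fingroup.
From mathcomp Require Import reals.
Set Implicit Arguments. Unset Strict Implicit. Unset Printing Implicit Defensive.
Import Order.TTheory GRing.Theory Num.Theory.
Local Open Scope ring_scope.

Definition perm_act (R : realType) (n : nat) (s : 'S_n) (v : 'rV[R]_n) : 'rV[R]_n :=
  \row_i v 0 (s^-1 i)%g.

Definition orbitSn (R : realType) (n : nat) (v : 'rV[R]_n) : seq 'rV[R]_n :=
  undup [seq perm_act s v | s <- enum [set: 'S_n]].

(* Hyperplane through the origin with normal vector a (a != 0): { x | a.x = 0 }. *)
Definition in_hyp (R : realType) (n : nat) (a x : 'rV[R]_n) : bool :=
  \sum_(i < n) a 0 i * x 0 i == 0.

Definition hyp_orbit_count (R : realType) (n : nat) (a v : 'rV[R]_n) : nat :=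
  size [seq x <- orbitSn v | in_hyp a x].

Definition admissible (R : realType) (n : nat) (v : 'rV[R]_n) : Prop :=
  injective (fun i : 'I_n => v 0 i) /\ \sum_(i < n) v 0 i != 0.

(* Main.v *)
Require Import Defs.
From HB Require Import structures.
From mathcomp Require Import all_boot all_order all_algebra all_fingroup.
From mathcomp Require Import reals.
From mathcomp Require Import ring zify.
Import Order.TTheory GRing.Theory Num.Theory.
Local Open Scope ring_scope.

(** The count is that of the permutations [s] with [f s = \sum_j a (s j) * v j = 0].
    A nonconstant [a] stays nonconstant on some [p] coordinates, and averaging over
    the permutations of these reduces the bound to level sets of [f] for [n = p].
    Sort [v] increasingly and mark the indices in [B = {i | a i0 < a i}], a proper
    nonempty set.  Moving a marked index one place to the right past an unmarked one
    strictly increases [f], so a level set is an antichain for the order generated by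
    these moves, which is graded by the sum of the positions of the marked indices.
    Weighting the moves as in an sl2-representation makes raising injective below the
    middle rank and lowering injective above it, so (Sperner) an antichain is no larger
    than one rank level.  Rotating the [p] positions shifts the rank by a unit multiple
    of the rotation amount mod [p], so a rank level has at most [p! / p] elements.

    Equality: [a = e_0] with [v = (0, 1, ..., n - 1)] for odd [n], and
    [a = e_0 + e_1 - (2 / n) (1, ..., 1)] with the same [v] for even [n]: then [f s = 0]
    says that the two entries moved to the places 0 and 1 sum to [n - 1]. *)

(** * Moves of adjacent entries and the sl2 operators that they define *)

Section Moves.
Context {R : rcfType} {m : nat}.
Implicit Types (B : {set 'I_m.+1}) (s : 'S_m.+1) (i j : 'I_m).

Definition lo i : 'I_m.+1 := widen_ord (leqnSn m) i.
Definition hi i : 'I_m.+1 := lift ord0 i.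
Definition swap i s : 'S_m.+1 := (tperm (lo i) (hi i) * s)%g.
Definition can_up B i s := (s (lo i) \in B) && (s (hi i) \notin B).
Definition can_down B i s := (s (lo i) \notin B) && (s (hi i) \in B).
Definition rank B s : nat := (\sum_(j | s j \in B) j)%N.

Lemma swapE i s x : swap i s x = s (tperm (lo i) (hi i) x).
Proof. by rewrite permM. Qed.

Lemma swap_lo i s : swap i s (lo i) = s (hi i).
Proof. by rewrite swapE tpermL. Qed.

Lemma swap_hi i s : swap i s (hi i) = s (lo i).
Proof. by rewrite swapE tpermR. Qed.

Lemma swapK i : involutive (swap i).
Proof. by move=> s; rewrite /swap mulgA tperm2 mul1g. Qed.

Lemma can_up_swap B i s : can_up B i (swap i s) = can_down B i s.
Proof. by rewrite /can_up /can_down swap_lo swap_hi andbC. Qed.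

Lemma can_down_swap B i s : can_down B i (swap i s) = can_up B i s.
Proof. by rewrite /can_up /can_down swap_lo swap_hi andbC. Qed.

Lemma can_upC B i s : can_up (~: B) i s = can_down B i s.
Proof. by rewrite /can_up /can_down !inE negbK. Qed.

Definition apart i j := (i.+1 < j)%N || (j.+1 < i)%N.

Lemma apart_tperm {i j} : apart i j ->
  (tperm (lo i) (hi i) (lo j) = lo j) * (tperm (lo i) (hi i) (hi j) = hi j).
Proof.
rewrite /apart => h; split; apply: tpermD; rewrite -val_eqE /= /bump /=; lia.
Qed.

Lemma can_up_apart B i j s : apart i j -> can_up B j (swap i s) = can_up B j s.
Proof. by move=> h; rewrite /can_up !swapE !(apart_tperm h). Qed.

Lemma can_down_apart B i j s : apart i j -> can_down B j (swap i s) = can_down B j s.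
Proof. by move=> h; rewrite /can_down !swapE !(apart_tperm h). Qed.

Lemma swap_apart i j s : apart i j -> swap i (swap j s) = swap j (swap i s).
Proof.
move=> h; rewrite /swap !mulgA; congr (_ * _)%g.
by rewrite [RHS]conjgC tpermJ !(apart_tperm h).
Qed.

Lemma not_apart i j : ~~ apart i j -> [\/ i = j, hi i = lo j | hi j = lo i].
Proof.
rewrite /apart negb_or -!leqNgt => /andP[h1 h2].
case: (ltngtP i j) => h.
- by apply: Or32; apply: val_inj; rewrite /= /bump /=; lia.
- by apply: Or33; apply: val_inj; rewrite /= /bump /=; lia.
- by apply: Or31; apply: val_inj.
Qed.

(** Apart moves commute, and reindexing by both swaps turns down moves into up moves. Overlapping
    moves share a position whose entry would have to be both marked and unmarked, so both sides
    vanish. *)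
Lemma cross_term B (x : 'S_m.+1 -> R) i j : i != j ->
  \sum_s (can_down B i s && can_down B j s)%:R * (x (swap i s) * x (swap j s)) =
  \sum_s (can_up B i s && can_up B j s)%:R * (x (swap i s) * x (swap j s)).
Proof.
move=> nij; have [h | /not_apart h] := boolP (apart i j).
  have h' : apart j i by rewrite /apart orbC.
  rewrite (reindex_inj (inv_inj (swapK i))) (reindex_inj (inv_inj (swapK j))) /=.
  apply: eq_bigr => s _; rewrite swapK (swap_apart _ _ _ h) swapK mulrC [x _ * _]mulrC mulrC.
  congr (_%:R * _).
  by rewrite -(swap_apart _ _ _ h) can_down_swap can_up_apart // (swap_apart _ _ _ h)
    can_down_swap can_up_apart.
case: h => [/eqP | e | e]; first by rewrite (negPf nij).
  all: rewrite !big1 // => s _; rewrite /can_up /can_down e;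
       do 3!(case: (_ \in B)); rewrite /= mul0r //.
Qed.

Lemma diag_term B (x : 'S_m.+1 -> R) i :
  \sum_s (can_down B i s)%:R * x (swap i s) ^+ 2 =
  \sum_s (can_up B i s)%:R * x s ^+ 2.
Proof.
rewrite (reindex_inj (inv_inj (swapK i))) /=.
by apply: eq_bigr => s _; rewrite swapK can_down_swap.
Qed.

Lemma diag_term_up B (x : 'S_m.+1 -> R) i :
  \sum_s (can_up B i s)%:R * x (swap i s) ^+ 2 =
  \sum_s (can_down B i s)%:R * x s ^+ 2.
Proof.
rewrite (reindex_inj (inv_inj (swapK i))) /=.
by apply: eq_bigr => s _; rewrite swapK can_up_swap.
Qed.

(* The squares satisfy [wt j ^+ 2 - wt (j - 1) ^+ 2 = m - 2 j], the weights of the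
   irreducible sl2-module of dimension [m + 1]; see [wt_sum]. *)
Definition wt i : R := Num.sqrt (i.+1 * (m - i))%N%:R.

(** Summation by parts: [(j + 1) * (m - j) - j * (m + 1 - j) = m - 2 * j], and both boundary weights
    are zero. *)
Lemma wt_sum (o : 'I_m.+1 -> R) :
  \sum_(i < m) wt i ^+ 2 * (o (lo i) - o (hi i)) =
  \sum_(j < m.+1) o j * (m%:R - 2 * j%:R).
Proof.
under eq_bigr => i _ do rewrite sqr_sqrtr ?ler0n // mulrBr.
rewrite sumrB.
pose w (j : 'I_m.+1) : R := (j.+1 * (m - j))%N%:R.
pose w' (j : 'I_m.+1) : R := (j * (m.+1 - j))%N%:R.
have -> : \sum_(i < m) (i.+1 * (m - i))%N%:R * o (lo i) = \sum_j w j * o j.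
  rewrite big_ord_recr /= /w /= subnn muln0 mul0r addr0.
  by apply: eq_bigr.
have -> : \sum_(i < m) (i.+1 * (m - i))%N%:R * o (hi i) = \sum_j w' j * o j.
  rewrite big_ord_recl /= /w' /= mul0n mul0r add0r.
  by apply: eq_bigr => i _; rewrite /= /bump /= add1n subSS.
rewrite -sumrB; apply: eq_bigr => j _.
rewrite -mulrBl mulrC; congr (_ * _); rewrite /w /w'.
have hj : (j <= m)%N by rewrite -ltnS.
rewrite (subSn hj) !natrM -!natr1 natrB //; ring.
Qed.

(** Indexed by the target: an up move reaches [s] from [swap i s] exactly when [can_down B i s]. *)
Definition raise B (x : 'S_m.+1 -> R) s :=
  \sum_(i < m) wt i * ((can_down B i s)%:R * x (swap i s)).
Definition lower B (x : 'S_m.+1 -> R) s :=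
  \sum_(i < m) wt i * ((can_up B i s)%:R * x (swap i s)).

Lemma sum_sqr_expand (c : 'I_m -> 'S_m.+1 -> bool) (x : 'S_m.+1 -> R) :
  \sum_s (\sum_(i < m) wt i * ((c i s)%:R * x (swap i s))) ^+ 2 =
  \sum_(i < m) \sum_(j < m) wt i * wt j *
    \sum_s (c i s && c j s)%:R * (x (swap i s) * x (swap j s)).
Proof.
under eq_bigr => s _ do rewrite expr2 mulr_suml.
rewrite exchange_big /=; apply: eq_bigr => i _.
under eq_bigr => s _ do rewrite mulr_sumr.
rewrite exchange_big /=; apply: eq_bigr => j _.
rewrite mulr_sumr; apply: eq_bigr => s _.
by rewrite -mulnb natrM; ring.
Qed.

(* The cross terms of the two squared norms agree by [cross_term]: this is
   [[lower, raise] = weight operator], [lower] being the transpose of [raise]. *)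
Lemma raise_lower B (x : 'S_m.+1 -> R) :
  \sum_s raise B x s ^+ 2 - \sum_s lower B x s ^+ 2 =
  \sum_s x s ^+ 2 * ((#|B| * m)%:R - 2 * (rank B s)%:R).
Proof.
rewrite !sum_sqr_expand -sumrB.
transitivity (\sum_(i < m) wt i ^+ 2 * \sum_s x s ^+ 2 *
   ((s (lo i) \in B)%:R - (s (hi i) \in B)%:R)).
  apply: eq_bigr => i _; rewrite -sumrB (bigD1 i) //= [X in _ + X]big1 ?addr0.
    rewrite -mulrBr -expr2; congr (_ * _).
    under eq_bigr => s _ do rewrite andbb -expr2.
    under [X in _ - X]eq_bigr => s _ do rewrite andbb -expr2.
    rewrite diag_term diag_term_up -sumrB; apply: eq_bigr => s _.
    rewrite /can_up /can_down -mulrBl mulrC.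
    by case: (_ \in B); case: (_ \in B); rewrite /= ?subrr.
  by move=> j nij; rewrite cross_term 1?eq_sym // subrr.
under eq_bigr => i _ do rewrite mulr_sumr.
rewrite exchange_big /=; apply: eq_bigr => s _.
under eq_bigr => i _ do rewrite mulrCA.
rewrite -mulr_sumr (wt_sum (fun j : 'I_m.+1 => (s j \in B)%:R)); congr (_ * _).
under eq_bigr => j _ do rewrite mulrBr.
rewrite sumrB; congr (_ - _).
  rewrite -mulr_suml natrM; congr (_ * _).
  rewrite -natr_sum; congr (_%:R).
  rewrite -sum1_card [RHS]big_mkcond [RHS](reindex_inj (@perm_inj _ s)) /=.
  by apply: eq_bigr => j _; case: (_ \in B).
rewrite /rank natr_sum mulr_sumr [RHS]big_mkcond /=.
by apply: eq_bigr => j _; case: (_ \in B); rewrite ?mul1r ?mul0r.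
Qed.

End Moves.

(** The rows in [S] and columns in [N] of [M] form a matrix with trivial left kernel, so it has no
    more rows than columns. *)
Lemma card_le_of_injective (F : fieldType) (T : finType) (S N : {set T})
    (M : T -> T -> F) :
  (forall x : T -> F, (forall s, s \notin S -> x s = 0) ->
     (forall t, t \in N -> \sum_s x s * M s t = 0) -> forall s, x s = 0) ->
  (#|S| <= #|N|)%N.
Proof.
move=> inj.
pose A : 'M[F]_(#|S|, #|N|) := \matrix_(i, j) M (enum_val i) (enum_val j).
suff /eqP <- : row_free A by apply: rank_leq_col.
rewrite -kermx_eq0; apply/eqP/row_matrixP => k; rewrite row0.
set u := row k _.
have uA : u *m A = 0 by rewrite /u -row_mul mulmx_ker row0.
pose x s := \sum_(i | enum_val i == s) u 0 i.
have xE i : x (enum_val i) = u 0 i.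
  rewrite /x (bigD1 i) //= big1 ?addr0 // => j /andP[/eqP/enum_val_inj -> /eqP //].
apply/rowP => i; rewrite -xE mxE; apply: inj => [s nS | t tN].
  by rewrite /x big1 // => j /eqP e; rewrite -e enum_valP in nS.
have /matrixP/(_ 0 (enum_rank_in tN t)) := uA.
rewrite !mxE => uA0; rewrite -[RHS]uA0 (bigID (mem S)) /= [X in _ + X]big1 ?addr0.
  rewrite big_enum_val /=; apply: eq_bigr => j _.
  by rewrite xE /A; congr (_ * _); rewrite mxE enum_rankK_in.
move=> s nS; rewrite /x big1 ?mul0r // => j /eqP e.
by rewrite -e enum_valP in nS.
Qed.

Lemma double_sum_ord m : (2 * \sum_(j < m.+1) j = m.+1 * m)%N.
Proof.
by rewrite -(big_mkord xpredT id) bin2_sum mulnC -[2%N]/(2`!) bin_ffact !ffactnS ffactn0 muln1.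
Qed.

(** * The order generated by the moves and its Sperner property *)

Section Antichains.
Context {m : nat}.
Implicit Types (B : {set 'I_m.+1}) (s : 'S_m.+1) (X : {set 'S_m.+1}).

Definition step B : rel 'S_m.+1 :=
  fun s t => [exists i, can_up B i s && (t == swap i s)].
Definition antichain B X :=
  {in X &, forall s t, connect (step B) s t -> s = t}.

Lemma stepC B s t : step (~: B) s t = step B t s.
Proof.
apply/existsP/existsP => -[i /andP[h /eqP ->]]; exists i; rewrite swapK eqxx andbT.
  by rewrite can_up_swap -can_upC.
by rewrite can_upC can_down_swap.
Qed.

Lemma connect_stepC B s t : connect (step (~: B)) s t = connect (step B) t s.
Proof.
transitivity (connect (fun x y => step B y x) s t); last exact: (connect_rev (step B)).
by apply: eq_connect => {}s {}t; exact: stepC.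
Qed.

Lemma antichainC B X : antichain (~: B) X <-> antichain B X.
Proof.
by split=> h s t sX tX; have := h t s tX sX; rewrite connect_stepC => /[apply] ->.
Qed.

Lemma connect_step_lt d (T : porderType d) (g : 'S_m.+1 -> T) B :
  (forall s t, step B s t -> (g s < g t)%O) ->
  forall s t, connect (step B) s t -> s = t \/ (g s < g t)%O.
Proof.
move=> gP s t /connectP[c cP ->] {t}.
elim: c s cP => [|u c IH] s /=; first by left.
case/andP=> /gP su /IH[<- | h]; right => //.
exact: lt_trans h.
Qed.

Lemma rank_step B s t : step B s t -> rank B t = (rank B s).+1.
Proof.
case/existsP=> i /andP[/andP[h1 h2] /eqP ->].
have nlh : hi i != lo i by rewrite -val_eqE /= /bump; lia.
rewrite /rank 2![in LHS]big_mkcond 2![in RHS]big_mkcond /=.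
rewrite (bigD1 (lo i)) // (bigD1 (hi i)) //=.
rewrite [in RHS](bigD1 (lo i)) // [in RHS](bigD1 (hi i)) //=.
rewrite swap_lo swap_hi h1 (negPf h2) /= add0n add0n.
rewrite [in LHS](eq_bigr (fun j : 'I__ => if s j \in B then (j : nat) else 0%N)).
  by rewrite /bump /= add1n addSn.
by move=> j /andP[j1 j2]; rewrite swapE tpermD // eq_sym.
Qed.

Lemma rankC B s : (rank B s + rank (~: B) s = \sum_(j < m.+1) j)%N.
Proof.
rewrite /rank [RHS](bigID (fun j => s j \in B)) /=; congr (_ + _)%N.
by apply: eq_bigl => j; rewrite inE.
Qed.

Definition shadow B X := [set t | [exists i, can_down B i t && (swap i t \in X)]].

Lemma shadowP B X t :
  reflect (exists2 s, s \in X & step B s t) (t \in shadow B X).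
Proof.
rewrite inE; apply: (iffP existsP) => [[i /andP[h hX]] | [s sX /existsP[i /andP[h /eqP ->]]]].
  by exists (swap i t) => //; apply/existsP; exists i; rewrite can_up_swap h swapK eqxx.
by exists i; rewrite can_down_swap h swapK.
Qed.

(* On vectors supported below the middle rank, raising is injective, because
   its squared norm exceeds that of the lowered vector by a positive amount. *)
Lemma card_shadow (R : rcfType) B X :
  {in X, forall s, (2 * rank B s < #|B| * m)%N} -> (#|X| <= #|shadow B X|)%N.
Proof.
move=> Xlow.
pose M s t : R := \sum_(i < m) wt i * ((can_down B i t)%:R * (s == swap i t)%:R).
apply: (card_le_of_injective _ _ _ _ M) => x xX xM.
have raiseE t : raise B x t = \sum_s x s * M s t.
  rewrite /raise /M; under [RHS]eq_bigr => s _ do rewrite mulr_sumr.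
  rewrite exchange_big /=; apply: eq_bigr => i _.
  rewrite (bigD1 (swap i t)) //= eqxx big1 ?addr0; first by rewrite /=; ring.
  by move=> s /negPf ->; rewrite !mulr0.
have raise0 t : raise B x t = 0.
  have [tN | tN] := boolP (t \in shadow B X); first by rewrite raiseE xM.
  rewrite /raise big1 // => i _.
  have [h | _] := boolP (can_down B i t); last by rewrite mul0r mulr0.
  rewrite xX ?mulr0 //; apply: contra tN => sX.
  by rewrite inE; apply/existsP; exists i; rewrite h.
have term_ge0 s : 0 <= x s ^+ 2 * ((#|B| * m)%:R - 2 * (rank B s)%:R).
  have [sX | /xX ->] := boolP (s \in X); last by rewrite expr0n mul0r.
  by rewrite mulr_ge0 ?sqr_ge0 // -natrM subr_ge0 ler_nat ltnW ?Xlow.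
have sum0 : \sum_s x s ^+ 2 * ((#|B| * m)%:R - 2 * (rank B s)%:R) = 0.
  apply/eqP; rewrite eq_le sumr_ge0 ?andbT // -raise_lower.
  rewrite big1 ?sub0r ?oppr_le0 ?sumr_ge0 // => s _; rewrite ?sqr_ge0 //.
  by rewrite raise0 expr0n.
move=> s; have [sX | /xX //] := boolP (s \in X).
move/eqP: sum0; rewrite psumr_eq0 // => /allP/(_ s).
rewrite mem_index_enum => /(_ isT); rewrite mulf_eq0 sqrf_eq0 => /orP[/eqP // |].
by rewrite -natrM subr_eq0 eqr_nat => /eqP e; have := Xlow s sX; rewrite e ltnn.
Qed.

(* Replacing the lowest elements of an antichain by their shadow keeps it an antichain
   and, below the middle rank, does not decrease its size. *)
Lemma push_up (R : rcfType) B c X : (2 * c <= (#|B| * m).+1)%N -> antichain B X ->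
  exists2 Y, antichain B Y /\ (#|X| <= #|Y|)%N &
    {in Y, forall s, (c <= rank B s)%N} /\
    forall u, (c <= u)%N -> {in X, forall s, (rank B s <= u)%N} ->
      {in Y, forall s, (rank B s <= u)%N}.
Proof.
move=> hc.
(* Induction on [d], which bounds how far below [c] the ranks in [X] may lie; each round lifts the
   lowest level. *)
suff: forall d X, antichain B X -> {in X, forall s, (c <= rank B s + d)%N} ->
  exists2 Y, antichain B Y /\ (#|X| <= #|Y|)%N &
    {in Y, forall s, (c <= rank B s)%N} /\
    forall u, (c <= u)%N -> {in X, forall s, (rank B s <= u)%N} ->
      {in Y, forall s, (rank B s <= u)%N}.
  by move=> H aX; apply: (H c X aX) => s _; rewrite leq_addl.
elim=> [|d IH] {}X aX hX.
  by exists X => //; split=> // s /hX; rewrite addn0.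
pose L := [set s in X | (rank B s + d < c)%N].
have rL s : s \in L -> (rank B s + d.+1 = c)%N.
  by rewrite inE => /andP[/hX]; lia.
have rN t : t \in shadow B L -> (rank B t + d = c)%N.
  by case/shadowP=> s /rL <- /rank_step ->; rewrite addnS.
have rD s : s \in X :\: L -> (c <= rank B s + d)%N.
  by rewrite !inE => /andP[/[swap] ->] /=; rewrite -leqNgt.
pose Z := (X :\: L) :|: shadow B L.
have conn_rank s t : connect (step B) s t -> s = t \/ (rank B s < rank B t)%N.
  by apply: (connect_step_lt _ _ (rank B)) => {}s {}t /rank_step ->; apply: leqnn.
have aZ : antichain B Z.
  (* Ranks exclude a proper path ending in the shadow. A path from the shadow into [X :\: L] extends
     down to [L], against [X] being an antichain. *)
  move=> s t /setUP[sX | sN] /setUP[tX | tN] st.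
  - by apply: aX => //; [case/setDP: sX | case/setDP: tX].
  - case: (conn_rank _ _ st) => // lt; have := rD _ sX; have := rN _ tN; lia.
  - case/shadowP: (sN) => w wL ws.
    have wX : w \in X by move: wL; rewrite inE => /andP[].
    have wt : w = t.
      apply: aX => //; first by case/setDP: tX.
      exact: connect_trans (connect1 ws) st.
    by case/setDP: tX; rewrite -wt wL.
  - by case: (conn_rank _ _ st) => // lt; have := rN _ sN; have := rN _ tN; lia.
have cZ : (#|X| <= #|Z|)%N.
  have -> : #|Z| = (#|X :\: L| + #|shadow B L|)%N.
    apply/eqP; rewrite eq_sym eqn_leq; apply/andP; split; last first.
      by rewrite cardsU leq_subr.
    rewrite cardsU [_ :&: _](_ : _ = set0) ?cards0 ?subn0 //.
    apply/setP => t; rewrite !inE; apply/negP => /andP[/andP[_ tX] tN].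
    have /shadowP[s sL st] : t \in shadow B L by rewrite inE.
    have sX : s \in X by move: sL; rewrite inE => /andP[].
    have e := aX _ _ sX tX (connect1 st).
    by move/rank_step: st; rewrite e => /eqP; rewrite ltn_eqF.
  rewrite -(cardsID L X) addnC leq_add2l.
  apply: leq_trans (card_shadow R B L _); first by rewrite subset_leq_card // subsetIr.
  by move=> s /rL; lia.
have hZ : {in Z, forall s, (c <= rank B s + d)%N}.
  by move=> s /setUP[/rD // | /rN ->].
have [Y [aY cY] [lY uY]] := IH Z aZ hZ.
exists Y; first by split=> //; apply: leq_trans cY.
split=> // u cu hu; apply: uY => // s /setUP[/setDP[/hu //] | /rN]; lia.
Qed.

(** Pushing up to rank at least [c], then down to rank at most [c], ends in a single level without
    loss of size. *)
Lemma antichain_le_middle (R : rcfType) B X : antichain B X ->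
  exists c, (#|X| <= #|[set s | rank B s == c]|)%N.
Proof.
move=> aX.
(* Rounding the middle rank up meets the condition of [push_up] both for [B] at [c] and for [~: B]
   at [t - c]. *)
pose c := uphalf (#|B| * m); pose t := (\sum_(j < m.+1) j)%N.
have [|Y [aY cY] [lY _]] := push_up R B c X _ aX.
  by rewrite /c; lia.
have te : (2 * t = m.+1 * m)%N by apply: double_sum_ord.
have cB : (#|B| + #|~: B| = m.+1)%N by rewrite cardsC card_ord.
have hct : (c <= t)%N.
  have : (#|B| * m <= m.+1 * m)%N by rewrite leq_mul2r; apply/orP; right; lia.
  by rewrite -te /c; lia.
have aY' : antichain (~: B) Y by apply/antichainC.
(* Complementing the marked set reverses the order, so that pushing up pushes down. *)
have [|Z [_ cZ] [lZ uZ]] := push_up R (~: B) (t - c) Y _ aY'.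
  have : (#|B| * m + #|~: B| * m = 2 * t)%N by rewrite -mulnDl cB te.
  by rewrite /c; lia.
exists c; apply: (leq_trans cY); apply: (leq_trans cZ).
apply/subset_leq_card/subsetP => s sZ; rewrite inE.
have := rankC B s; rewrite -/t => e.
have h1 := lZ s sZ.
(* The second push keeps the bound [t - c] on the complementary rank, so nothing falls below rank
   [c] again. *)
have h2 : (rank (~: B) s <= t - c)%N.
  apply: (uZ (t - c)%N) => // w wY; have := rankC B w; rewrite -/t; have := lY w wY; lia.
by apply/eqP; lia.
Qed.

End Antichains.

(** * Counting a rank level by rotations *)

Section Rotation.
Context {m : nat}.
Implicit Types (B : {set 'I_m.+1}) (s : 'S_m.+1) (t : 'I_m.+1).

Definition rotate t s : 'S_m.+1 := (perm (@addrI _ t) * s)%g.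

(** Addition in ['I_m.+1] is cyclic, so a rotation shifts each of the [#|B|] marked positions back
    by [t] modulo [m.+1]. *)
Lemma rank_rotate B t s :
  (rank B (rotate t s) + t * #|B| = rank B s %[mod m.+1])%N.
Proof.
have -> : (t * #|B| = \sum_(j | rotate t s j \in B) t)%N.
  rewrite sum_nat_const mulnC; congr (_ * _)%N.
  by rewrite -(card_preimset B (@perm_inj _ (rotate t s))); apply: eq_card => j; rewrite !inE.
rewrite /rank -big_split /= -modn_summ.
rewrite [in RHS](reindex_inj (@addrI _ t)) /= -[in RHS]modn_summ.
congr (_ %% _)%N; apply: eq_big => [j | j _]; first by rewrite /rotate permM permE.
by rewrite /= modn_mod addnC.
Qed.

(** [#|B|] is invertible modulo the prime [m.+1], so at most one rotation of each [s] has rank [c];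
    summing over all rotations counts the level [m.+1] times. *)
Lemma card_rank_level B c : prime m.+1 -> (0 < #|B| < m.+1)%N ->
  (m.+1 * #|[set s | rank B s == c]| <= (m.+1)`!)%N.
Proof.
move=> pr /andP[B0 Bm].
have copr : coprime m.+1 #|B| by rewrite prime_coprime // gtnNdvd.
have -> : (m.+1 * #|[set s | rank B s == c]| =
    \sum_(t < m.+1) \sum_s (rank B (rotate t s) == c))%N.
  rewrite -[X in (X * _)%N]card_ord -sum_nat_const; apply: eq_bigr => t _.
  rewrite -sum1_card big_mkcond (reindex_inj (@mulgI _ (perm (@addrI _ t)))) /=.
  by apply: eq_bigr => s _; rewrite inE -/(rotate t s); case: eqP.
rewrite exchange_big /= -card_Sn -sum1_card [leqRHS]big_mkcond /=.
apply: leq_sum => s _.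
have [/existsP[t0 /eqP e0] | ] := boolP [exists t : 'I_m.+1, rank B (rotate t s) == c].
  rewrite (bigD1 t0) //= e0 eqxx big1 // => t nt.
  apply/eqP; rewrite eqb0; apply: contra nt => /eqP e.
  have := rank_rotate B t s; rewrite -(rank_rotate B t0 s) e e0.
  move/eqP; rewrite eqn_modDl.
  wlog le : t t0 {e e0} / (t0 <= t)%N => [H | ].
    by case/orP: (leq_total t0 t) => h; [apply: H | rewrite eq_sym => /(H _ _ h); rewrite eq_sym].
  rewrite eqn_mod_dvd ?leq_mul2r ?le ?orbT // -mulnBl Gauss_dvdl // => d.
  rewrite -val_eqE /=; have := ltn_ord t; case: (posnP (t - t0)) d => [|pos d lt]; first by lia.
  by have := dvdn_leq pos d; lia.
rewrite negb_exists => /forallP h.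
by rewrite big1 // => t _; apply/eqP; rewrite eqb0.
Qed.

End Rotation.

(** * Level sets of the linear form for prime length *)

Lemma level_set_sorted (R : rcfType) m (a v : 'I_m.+1 -> R) (c : R) :
  prime m.+1 -> {homo v : i j / (i < j)%N >-> i < j} ->
  (exists i j, a i != a j) ->
  (m.+1 * #|[set s : 'S_m.+1 | (\sum_j a (s j) * v j == c)%R]| <= (m.+1)`!)%N.
Proof.
move=> pr vinc [i0 [i1 ne]].
wlog lt01 : i0 i1 ne / a i0 < a i1.
  by move=> H; case/orP: (lt_total ne) => h; [apply: (H i0 i1) | apply: (H i1 i0) => //; rewrite eq_sym].
(* The cut at [a i0] leaves [i0] out and [i1] in, and every marked value of [a] exceeds every
   unmarked one. *)
pose B := [set i | a i0 < a i].
have Bbd : (0 < #|B| < m.+1)%N.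
  apply/andP; split; first by apply/card_gt0P; exists i1; rewrite inE.
  rewrite -[ltnRHS](card_ord m.+1) -cardsT; apply: proper_card.
  by rewrite properT; apply/negP => /eqP e; have := in_setT i0; rewrite -e inE ltxx.
pose g (s : 'S_m.+1) := \sum_j a (s j) * v j.
have gstep (s t : 'S_m.+1) : step B s t -> g s < g t.
  case/existsP=> i /andP[/andP[]]; rewrite !inE -leNgt => h1 h2 /eqP ->.
  have nlh : hi i != lo i by rewrite -val_eqE /= /bump; lia.
  rewrite /g (bigD1 (lo i)) // (bigD1 (hi i)) //= [ltRHS](bigD1 (lo i)) // (bigD1 (hi i)) //=.
  rewrite swap_lo swap_hi.
  rewrite (eq_bigr (fun j => a (swap i s j) * v j)); last first.
    by move=> j /andP[j1 j2]; rewrite swapE tpermD // eq_sym.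
  rewrite !addrA ltrD2r -subr_gt0.
  have vlt : v (lo i) < v (hi i) by apply: vinc; rewrite /= /bump /=; lia.
  have -> : a (s (hi i)) * v (lo i) + a (s (lo i)) * v (hi i)
      - (a (s (lo i)) * v (lo i) + a (s (hi i)) * v (hi i))
    = (a (s (lo i)) - a (s (hi i))) * (v (hi i) - v (lo i)) by ring.
  by rewrite mulr_gt0 // subr_gt0 // (le_lt_trans h2).
have [|c' le] := antichain_le_middle R B [set s | g s == c].
  move=> s t; rewrite !inE => /eqP es /eqP et st.
  by case: (connect_step_lt _ R g B gstep s t st) => //; rewrite es et ltxx.
apply: leq_trans (card_rank_level B c' pr Bbd).
by rewrite leq_mul2l le orbT.
Qed.

Lemma exists_sorting_perm (R : realDomainType) n (v : 'I_n -> R) : injective v ->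
  exists s : 'S_n, {homo (v \o s) : i j / (i < j)%N >-> i < j}.
Proof.
move=> vinj.
have rk_lt i : (#|[set j | (v j < v i)%R]| < n)%N.
  rewrite -[ltnRHS](card_ord n) -cardsT; apply: proper_card.
  by rewrite properT; apply/negP => /eqP e; have := in_setT i; rewrite -e inE ltxx.
pose rk i := Ordinal (rk_lt i).
have rk_mono i j : v i < v j -> (rk i < rk j)%N.
  move=> lt /=; apply: proper_card; apply/properP; split.
    by apply/subsetP => x; rewrite !inE => /lt_trans; apply.
  by exists i; rewrite inE // ltxx.
have rk_inj : injective rk.
  move=> i j e; apply: vinj; apply/eqP; case: ltgtP => // /rk_mono; by rewrite e ltnn.
exists (perm rk_inj)^-1%g => i j lt /=.
set s := (perm rk_inj)^-1%g.
have sK x : rk (s x) = x by rewrite -(permE rk_inj) permKV.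
rewrite ltNge; apply/negP; rewrite le_eqVlt => /orP[/eqP/vinj e | /rk_mono].
  by move: lt; rewrite -(sK i) -(sK j) e ltnn.
by rewrite !sK ltnNge ltnW.
Qed.

Lemma level_set_prime (R : rcfType) p (a v : 'I_p -> R) (c : R) :
  prime p -> injective v -> (exists i j, a i != a j) ->
  (p * #|[set s : 'S_p | (\sum_j a (s j) * v j == c)%R]| <= p`!)%N.
Proof.
case: p a v => [|m] a v pr vinj nca; first by [].
have [t tinc] := exists_sorting_perm R m.+1 v vinj.
have := level_set_sorted R m a (v \o t) c pr tinc nca; apply: leq_trans.
rewrite leq_mul2l /=.
rewrite -[leqRHS](card_preimset _ (@mulgI _ t)); apply/subset_leq_card/subsetP => s.
rewrite !inE => /eqP <-; rewrite [eqbRHS](reindex_inj (@perm_inj _ t)).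
by apply/eqP; apply: eq_bigr => j _; rewrite permM.
Qed.

(** * Reduction from [n] coordinates to a prime number of them *)

Lemma exists_perm2 (T : finType) (x y x' y' : T) : x != y -> x' != y' ->
  exists g : {perm T}, g x = x' /\ g y = y'.
Proof.
move=> nxy nxy'; exists (tperm x x' * tperm (tperm x x' y) y')%g.
rewrite !permM tpermL; split; last by rewrite tpermL.
apply: tpermD; last by rewrite eq_sym.
by rewrite -[X in _ != X](tpermL x) (inj_eq perm_inj) eq_sym.
Qed.

Section Extension.
Context {S T : finType} (f : S -> T) (f_inj : injective f).

Definition extend_fun (s : {perm S}) (x : T) : T :=
  if [pick j | f j == x] is Some j then f (s j) else x.

Lemma extend_fun_in s j : extend_fun s (f j) = f (s j).
Proof.
rewrite /extend_fun; case: pickP => [i /eqP/f_inj -> // | /(_ j)].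
by rewrite eqxx.
Qed.

Lemma extend_fun_out s x : x \notin codom f -> extend_fun s x = x.
Proof.
rewrite /extend_fun; case: pickP => // i /eqP <-.
by rewrite codom_f.
Qed.

Lemma extend_fun_inj s : injective (extend_fun s).
Proof.
apply: (can_inj (g := extend_fun s^-1)) => x.
have [/codomP[j ->] | nx] := boolP (x \in codom f).
  by rewrite !extend_fun_in permK.
by rewrite !extend_fun_out.
Qed.

Definition extend (s : {perm S}) : {perm T} := perm (@extend_fun_inj s).

End Extension.

(** Right multiplication by a copy of ['S_p] permutes [p] chosen coordinates of [a]. Around each [s]
    this gives a level set for [p], and averaging over [s] gives the bound. *)
Lemma level_set_le (R : rcfType) n p (a v : 'I_n -> R) (c : R) :
  prime p -> (p <= n)%N -> injective v -> (exists i j, a i != a j) ->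
  (p * #|[set s : 'S_n | (\sum_j a (s j) * v j == c)%R]| <= n`!)%N.
Proof.
move=> pr le vinj [i0 [i1 ne]].
have p1 := prime_gt1 pr.
have ne01 : i0 != i1 by apply: contraNneq ne => ->.
pose o0 : 'I_p := Ordinal (ltnW p1); pose o1 : 'I_p := Ordinal p1.
(* [g] puts two indices with different values of [a] among the [p] chosen ones. *)
have [g [g0 g1]] := @exists_perm2 _ (widen_ord le o0) (widen_ord le o1) i0 i1 isT ne01.
pose f j := g (widen_ord le j).
have f_inj : injective f.
  by move=> i j /perm_inj/(congr1 val)/= e; apply: val_inj.
have af : exists i j, a (f i) != a (f j) by exists o0, o1; rewrite /f g0 g1.
set X := [set s | _].
have bound s : (p * #|[set t : 'S_p | (s * extend f f_inj t)%g \in X]| <= p`!)%N.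
  (* The extension fixes the indices outside the image of [f], so their contribution does not depend
     on [t]. *)
  pose c' := c - \sum_(i | i \notin codom f) a i * v (s^-1%g i).
  have vinj' : injective (v \o s^-1%g \o f).
    by apply: inj_comp => //; apply: inj_comp => //; apply: perm_inj.
  apply: leq_trans (level_set_prime R p (a \o f) _ c' pr vinj' af).
  rewrite leq_mul2l; apply/orP; right; apply/subset_leq_card/subsetP => t.
  rewrite !inE /c' => /eqP <-; rewrite eq_sym subr_eq; apply/eqP.
  rewrite (reindex_inj (@perm_inj _ s^-1%g)) /=.
  rewrite (bigID (mem (codom f))) /=; congr (_ + _).
    rewrite -big_uniq ?(map_inj_uniq f_inj) ?enum_uniq //= big_map big_enum /=.
    by apply: eq_bigr => j _; rewrite permM permKV permE extend_fun_in.
  apply: eq_bigr => i ni; rewrite permM permKV permE extend_fun_out //.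
have : (p * (p`! * #|X|) <= p`! * n`!)%N.
  have -> : (p`! * #|X| = \sum_s #|[set t : 'S_p | (s * extend f f_inj t)%g \in X]|)%N.
    under eq_bigr => s _ do rewrite -sum1_card big_mkcond.
    rewrite exchange_big /= -(card_Sn p) -sum_nat_const; apply: eq_bigr => t _.
    rewrite -(card_preimset _ (@mulIg _ (extend f f_inj t))) -sum1_card big_mkcond.
    by apply: eq_bigr => s _; rewrite !inE.
  rewrite big_distrr /= -[n`!]card_Sn mulnC -sum_nat_const.
  by apply: leq_sum => s _; apply: bound.
by rewrite mulnCA leq_mul2l gtn_eqF ?fact_gt0.
Qed.

(** * From orbit points to permutations *)

Lemma hyp_orbit_countE (R : realType) n (a v : 'rV[R]_n) : admissible v ->
  hyp_orbit_count a v =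
  #|[set s : 'S_n | (\sum_j a 0 (s j) * v 0 j == 0)%R]|.
Proof.
(* Distinct entries make distinct permutations give distinct points, so [undup] drops nothing;
   reindexing by [s] moves the permutation from [v] to [a]. *)
case=> vinj _; rewrite /hyp_orbit_count /orbitSn undup_id.
  rewrite size_filter count_map -size_filter cardE; congr size.
  rewrite enum_setT; apply: eq_filter => s /=.
  rewrite !inE /in_hyp (reindex_inj (@perm_inj _ s)) /=.
  by congr (_ == _); apply: eq_bigr => j _; rewrite mxE permK.
rewrite map_inj_uniq ?enum_uniq // => s t /rowP e.
apply: invg_inj; apply/permP => i; apply: vinj.
by have := e i; rewrite !mxE.
Qed.

Lemma hyp_orbit_count_le (R : realType) n p (a v : 'rV[R]_n) :
  prime p -> (p <= n)%N -> admissible v -> a != 0 ->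
  (hyp_orbit_count a v <= n`! %/ p)%N.
Proof.
move=> pr le adm a0; rewrite hyp_orbit_countE // leq_divRL ?prime_gt0 // mulnC.
case: (adm) => vinj v0.
have [/existsP[i /existsP[j ne]] | ] := boolP [exists i, exists j, a 0 i != a 0 j].
  by apply: (level_set_le R n p (a 0) (v 0) 0) => //; exists i, j.
(* For constant [a] the form is a nonzero multiple of the coordinate sum of [v], so no point is
   counted. *)
rewrite negb_exists => /forallP ac.
rewrite (_ : [set _ | _] = set0) ?cards0 ?muln0 //; apply/setP => s; rewrite !inE.
apply/negP => sum0; case/negP: a0; apply/eqP/rowP => i; rewrite mxE.
have aE j : a 0 j = a 0 i.
  apply/eqP; have := ac j; rewrite negb_exists => /forallP/(_ i).
  by rewrite negbK.
move: sum0; under eq_bigr => j _ do rewrite aE.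
by rewrite -mulr_sumr mulf_eq0 (negPf v0) orbF => /eqP.
Qed.

(** * Vectors and hyperplanes attaining the bound *)

Lemma card_perm_fix2 (T : finType) (x y x' y' : T) : x != y -> x' != y' ->
  #|[set s : {perm T} | (s x == x') && (s y == y')]| = (#|T| - 2)`!.
Proof.
move=> nxy nxy'; have [g [gx gy]] := exists_perm2 T x y x' y' nxy nxy'.
rewrite -(card_preimset _ (@mulIg _ g)).
have <- : #|~: [set x; y]| = (#|T| - 2)%N.
  by have := cardsC [set x; y]; rewrite cards2 nxy; lia.
rewrite -card_perm; apply: eq_card => s.
rewrite !inE !permM -gx -gy !(inj_eq perm_inj).
apply/andP/subsetP => [[/eqP sx /eqP sy] z | h].
  by rewrite !inE negb_or => nz; apply/andP; split; apply: contraNneq nz => ->; rewrite ?sx ?sy.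
have fixed z : z \in [set x; y] -> s z == z.
  by apply: contraLR => nz; have := h z nz; rewrite inE.
by rewrite !fixed // !inE eqxx ?orbT.
Qed.

Lemma card_perm_fix1 (T : finType) (x : T) :
  #|[set s : {perm T} | s x == x]| = (#|T|.-1)`!.
Proof.
have <- : #|~: [set x]| = #|T|.-1 by have := cardsC [set x]; rewrite cards1; lia.
rewrite -card_perm; apply: eq_card => s; rewrite inE.
apply/idP/subsetP => [/eqP sx z | h].
  by rewrite !inE => nz; apply: contraNneq nz => ->; rewrite sx.
by apply: contraT => nz; have := h x nz; rewrite !inE eqxx.
Qed.

Definition ramp (R : realType) n : 'rV[R]_n := \row_i (i : nat)%:R.

Lemma ramp_admissible (R : realType) n : (2 <= n)%N -> admissible (ramp R n).
Proof.
move=> n2; split=> [i j /= | ].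
  by rewrite !mxE => /eqP; rewrite eqr_nat => /eqP/val_inj.
under eq_bigr => i _ do rewrite mxE.
rewrite -natr_sum pnatr_eq0 sum_nat_eq0; apply/negP => /forallP/(_ (Ordinal n2)).
by [].
Qed.

Lemma coordinate_hyperplane_count (R : realType) n :
  (n.+1`! <= hyp_orbit_count (delta_mx 0%R ord0) (ramp R n.+2))%N.
Proof.
rewrite hyp_orbit_countE; last exact: ramp_admissible.
have := card_perm_fix1 'I_n.+2 ord0; rewrite [X in X.-1]card_ord /= => <-.
apply/subset_leq_card/subsetP => s; rewrite !inE => /eqP s0.
apply/eqP; rewrite big1 // => j _; rewrite !mxE eqxx /= -[X in _ == X]s0 (inj_eq perm_inj).
by case: eqP => [-> | _]; rewrite ?mulr0 ?mul0r.
Qed.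

(** The permutations are sorted by the index [x] sent to 0, and those sending its mirror [rev_ord x]
    to 1 are kept. The two entries sum to [n.+1], twice the mean of all entries, which the term
    [2 / n.+2] cancels. *)
Lemma pair_hyperplane_count (R : realType) n : ~~ odd n ->
  (n.+2 * n`! <=
   hyp_orbit_count (\row_(i < n.+2) ((i < 2)%N%:R - 2 / n.+2%:R)%R) (ramp R n.+2))%N.
Proof.
move=> even_n; rewrite hyp_orbit_countE; last exact: ramp_admissible.
pose i1 : 'I_n.+2 := lift ord0 ord0.
rewrite -sum1_card (partition_big (fun s : 'S_n.+2 => (s^-1)%g ord0) xpredT) //=.
rewrite -[X in (X * _)%N](card_ord n.+2) -sum_nat_const; apply: leq_sum => x _.
(* The two indices sum to [n.+1], which is odd. *)
have nrev : x != rev_ord x.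
  rewrite -val_eqE /=; apply/eqP => e; have := ltn_ord x; lia.
have <- : #|[set s : 'S_n.+2 | (s x == ord0) && (s (rev_ord x) == i1)]| = n`!.
  by rewrite card_perm_fix2 // card_ord subn2.
rewrite sum1dep_card; apply/subset_leq_card/subsetP => s.
rewrite !inE => /andP[/eqP sx /eqP sy]; rewrite -sx permK eqxx andbT.
have terms j : (s j < 2)%N = (j == x) || (j == rev_ord x).
  rewrite -[j == x](inj_eq (@perm_inj _ s)) -[j == rev_ord x](inj_eq (@perm_inj _ s)) sx sy.
  by rewrite -!val_eqE /=; case: (nat_of_ord (s j)) => [|[|]].
apply/eqP; under eq_bigr => j _ do rewrite !mxE terms mulrBl.
rewrite sumrB -mulr_sumr -natr_sum.
rewrite (bigD1 x) // (bigD1 (rev_ord x)) 1?eq_sym //= !eqxx orbT /= big1 ?addr0; last first.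
  by move=> j /andP[/negPf -> /negPf ->]; rewrite mul0r.
rewrite !mul1r -natrD (_ : (x + _ = n.+1)%N); last by have := ltn_ord x; rewrite /=; lia.
have := double_sum_ord n.+1 => /(congr1 (fun k => k%:R : R)); rewrite !natrM => e.
have n0 : n.+2%:R != 0 :> R by rewrite pnatr_eq0.
rewrite mulrAC e mulrC mulKf ?subrr //.
Qed.

Theorem theorem1p5 (R : realType) (n p : nat)
  (hn : (2 <= n)%N) (hp : prime p) (hpn : (p <= n)%N)
  (hpmax : forall q : nat, prime q -> (q <= n)%N -> (q <= p)%N) :
  (forall v a : 'rV[R]_n, admissible v -> a != 0 ->
     (hyp_orbit_count a v <= n`! %/ p)%N)
  /\
  ((3 <= n)%N -> (n = p \/ n = p.+1) ->
    let M := if odd n then (n.-1)`! else (n * (n.-2)`!)%N in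
    (forall v a : 'rV[R]_n, admissible v -> a != 0 -> (hyp_orbit_count a v <= M)%N)
    /\ (exists v a : 'rV[R]_n, [/\ admissible v, a != 0 & hyp_orbit_count a v = M])).
Proof.
have le_div (v a : 'rV[R]_n) : admissible v -> a != 0 ->
    (hyp_orbit_count a v <= n`! %/ p)%N by apply: hyp_orbit_count_le.
split=> // n3 np M.
(* [p] is odd: [p = 2] would leave [n = 3], a larger prime. *)
have np' : if odd n then n = p else n = p.+1.
  case: np => e; rewrite e in n3 hpmax *.
    by case: (even_prime hp) => [p2 | ->] //; rewrite p2 in n3.
  case: (even_prime hp) => [p2 | /= ->] //.
  by have := hpmax 3 isT n3; rewrite p2.
have Mdiv : (n`! %/ p)%N = M.
  rewrite /M; case: (odd n) np' => e.
    by rewrite -e -{1}(ltn_predK n3) factS (ltn_predK n3) mulKn // (ltnW (ltnW n3)).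
  rewrite e factS /= -{2}(prednK (prime_gt0 hp)) factS (prednK (prime_gt0 hp)).
  by rewrite mulnCA mulKn ?prime_gt0.
rewrite -Mdiv; split=> //; rewrite Mdiv /M.
clear M Mdiv np; exists (ramp R n).
case on: (odd n) np' => e.
  case: n on n3 e le_div {hn hpn hpmax} => [|[|n]] // on n3 e le_div.
  have a0 : delta_mx 0 ord0 != 0 :> 'rV[R]_n.+2.
    by apply/eqP => /matrixP/(_ 0 ord0)/eqP; rewrite !mxE !eqxx oner_eq0.
  exists (delta_mx 0 ord0); split=> //; first exact: ramp_admissible.
  apply/eqP; rewrite eqn_leq coordinate_hyperplane_count andbT.
  apply: leq_trans (le_div _ _ _ a0) _; first exact: ramp_admissible.
  by rewrite -e factS mulKn.
case: n on n3 e le_div {hn hpn hpmax} => [|[|n]] // on n3 e le_div.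
have even_n : ~~ odd n by move: on => /= /negbT; rewrite negbK.
pose a : 'rV[R]_n.+2 := \row_i ((i < 2)%N%:R - 2 / n.+2%:R).
have a0 : a != 0.
  (* The entry at 0 is [1 - 2 / n.+2], which vanishes only in dimension 2. *)
  apply/eqP => /matrixP/(_ 0 ord0)/eqP; rewrite !mxE /= subr_eq0 => /eqP h.
  have n0 : n.+2%:R != 0 :> R by rewrite pnatr_eq0.
  move: h => /(congr1 (fun y => y * n.+2%:R)); rewrite mul1r mulfVK // => /eqP.
  by rewrite eqr_nat; move: n3; case: (n).
exists a; split=> //; first exact: ramp_admissible.
apply/eqP; rewrite eqn_leq pair_hyperplane_count // andbT.
apply: leq_trans (le_div _ _ _ a0) _; first exact: ramp_admissible.
by case: e => <-; rewrite !factS mulnCA mulKn.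
Qed.
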